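(* There is a constant $\sigma\in(0,1)$ (depending only on $n,\pi,\nu$) such that for every choice of $\lambda_0>0$ and $a>0$ the sequence $(\lambda_k)$ defined, for $k=0,1,2,\dots$, by $$\psi_k(1)=-a,\qquad \psi_k(i+1)=\psi_k(i)+\frac{\{[\psi_k(i)-\psi_k(i-1)]\nu(i-1,i)-\lambda_k\pi(i)\psi_k(i)\}^+}{\nu(i,i+1)}\quad(1\le i<n),$$ $$\lambda_{k+1}=\frac{\mathcal{E}_\nu(\psi_k,\psi_k)}{\mathrm{Var}_\pi(\psi_k)},$$ satisfies $0\le\lambda_k-\lambda^G_{\pi,\nu}\le\sigma^{k-1}\lambda_1$ for all $k\ge1$.
   Context: Let $n\ge2$, $V=\{1,\dots,n\}$, $E=\{\{i,i+1\}:1\le i\le n-1\}$ and $G=(V,E)$. Let $\pi$ be a positive measure on $V$ with $\pi(V)=\sum_{i}\pi(i)=1$ and $\nu$ a positive measure on $E$ (write $\nu(i,i+1)=\nu(i+1,i)>0$), with the convention $\nu(0,1)=\nu(n,n+1)=0$ (so terms multiplied by these coefficients vanish). For functions $f,g$ on $V$ put $\pi(f)=\sum_i f(i)\pi(i)$, $\mathcal{E}_\nu(f,g)=\sum_{i=1}^{n-1}[f(i)-f(i+1)][g(i)-g(i+1)]\nu(i,i+1)$ and $\mathrm{Var}_\pi(f)=\pi(f^2)-\pi(f)^2$. The spectral gap is $\lambda^G_{\pi,\nu}=\min\{\mathcal{E}_\nu(f,f)/\mathrm{Var}_\pi(f): f \text{ non-constant}\}$. Notation: $t^+=\max\{t,0\}$.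 *)

(* Defs.v *)
From mathcomp Require Import all_boot all_order all_algebra.
From mathcomp Require Import all_classical all_reals all_analysis.
From mathcomp Require Import ring lra.

Set Implicit Arguments.
Unset Strict Implicit.
Unset Printing Implicit Defensive.

Import Order.TTheory GRing.Theory Num.Theory.
Import numFieldNormedType.Exports.

Local Open Scope classical_set_scope.
Local Open Scope ring_scope.

(* The path has vertices 1, ..., n. A function or measure on the vertices is a
   map [nat -> R] of which only the values at 1, ..., n matter, and [nu i] is
   the weight of the edge {i, i+1}; so nu(0,1) is [nu 0] and nu(n,n+1) is
   [nu n]. *)

Definition mean (R : realType) (n : nat) (pi f : nat -> R) : R :=
  \sum_(1 <= i < n.+1) f i * pi i.

Definition dirichlet (R : realType) (n : nat) (nu f g : nat -> R) : R :=
  \sum_(1 <= i < n) (f i - f i.+1) * (g i - g i.+1) * nu i.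

Definition var (R : realType) (n : nat) (pi f : nat -> R) : R :=
  mean n pi (fun i => f i ^+ 2) - mean n pi f ^+ 2.

Definition nonconstant (R : realType) (n : nat) (f : nat -> R) : Prop :=
  exists i j : nat,
    [/\ (1 <= i <= n)%N, (1 <= j <= n)%N & f i <> f j].

(* The infimum is a minimum: see [spectral_gap_min] below. *)
Definition spectral_gap (R : realType) (n : nat) (pi nu : nat -> R) : R :=
  inf [set dirichlet n nu f f / var n pi f | f in nonconstant n].

Section SpectralGapMin.
Variables (R : realType) (n : nat) (pi nu : nat -> R).
Hypothesis n2 : (2 <= n)%N.
Hypothesis pi0 : forall i, (1 <= i <= n)%N -> 0 < pi i.
Hypothesis pi1 : \sum_(1 <= i < n.+1) pi i = 1.
Hypothesis nu0 : forall i, (1 <= i < n)%N -> 0 < nu i.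

Let mean_lin (c d : R) f :
  mean n pi (fun i => c * f i + d) = c * mean n pi f + d.
Proof.
rewrite /mean (eq_bigr (fun i => c * (f i * pi i) + d * pi i)); last first.
  by move=> i _; ring.
by rewrite big_split /= -!mulr_sumr pi1 mulr1.
Qed.

Let var_center f :
  var n pi f = mean n pi (fun i => (f i - mean n pi f) ^+ 2).
Proof.
rewrite /var; set m := mean n pi f.
rewrite {2}/mean (eq_bigr (fun i =>
  f i ^+ 2 * pi i - (2 * m) * (f i * pi i) + m ^+ 2 * pi i)); last first.
  by move=> i _; ring.
rewrite big_split /= sumrB -!mulr_sumr pi1 -/(mean n pi f) -/m /mean; ring.
Qed.

Let var_gt0 f : nonconstant n f -> 0 < var n pi f.
Proof.
move=> [i [j [hi hj fij]]]; rewrite var_center; set m := mean n pi f.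
have [k hk fk] : exists2 k, (1 <= k <= n)%N & f k != m.
  have [fi|] := eqVneq (f i) m; last by exists i.
  by exists j => //; apply/eqP => fj; apply: fij; rewrite fi fj.
rewrite /mean (bigD1_seq k) ?iota_uniq ?mem_index_iota//=.
apply: ltr_pwDl.
  by rewrite mulr_gt0 ?pi0// lt_neqAle sqr_ge0 eq_sym sqrf_eq0 subr_eq0 fk.
rewrite big_seq_cond sumr_ge0// => l; rewrite mem_index_iota => /andP[hl _].
by rewrite mulr_ge0 ?sqr_ge0// ltW// pi0.
Qed.

Let dirichlet_ge0 f : 0 <= dirichlet n nu f f.
Proof.
rewrite /dirichlet big_seq_cond sumr_ge0// => i.
rewrite mem_index_iota => /andP[hi _].
by rewrite mulr_ge0 -?expr2 ?sqr_ge0// ltW// nu0.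
Qed.

Let vec (f : nat -> R) : 'rV[R]_n.-1.+1 := \row_j f j.+1.
Let fct (v : 'rV[R]_n.-1.+1) (i : nat) : R := v ord0 (inord i.-1).

Let vecK f i : (1 <= i <= n)%N -> fct (vec f) i = f i.
Proof.
by case: i => // i /= hi; rewrite /fct mxE inordK// (ltn_predK n2).
Qed.

Let fct_cont i : continuous (fct^~ i).
Proof. exact: coord_continuous. Qed.

Let sphere : set 'rV[R]_n.-1.+1 :=
  [set v | mean n pi (fct v) = 0] `&`
  [set v | mean n pi (fun i => fct v i ^+ 2) = 1].

Let contM (T : topologicalType) (f g : T -> R) :
  continuous f -> continuous g -> continuous (fun x => f x * g x).
Proof. by move=> cf cg x; apply: cvgM; [exact: cf | exact: cg]. Qed.

Let contB (T : topologicalType) (f g : T -> R) :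
  continuous f -> continuous g -> continuous (fun x => f x - g x).
Proof. by move=> cf cg x; apply: cvgB; [exact: cf | exact: cg]. Qed.

Let mean_cont (F : 'rV[R]_n.-1.+1 -> nat -> R) :
  (forall i, continuous (F^~ i)) -> continuous (fun v => mean n pi (F v)).
Proof.
move=> cF; rewrite /mean; apply: continuous_big.
  exact: add_continuous.
by move=> i _; apply: contM; [exact: cF | exact: cst_continuous].
Qed.

Let sphere_closed : closed sphere.
Proof.
apply: closedI.
  have /continuous_closedP := mean_cont fct_cont.
  by move=> /(_ _ (@closed_eq R 0)).
have /mean_cont/continuous_closedP : forall i,
    continuous (fun v : 'rV[R]_n.-1.+1 => fct v i ^+ 2).
  by move=> i; apply: contM; exact: fct_cont.
by move=> /(_ _ (@closed_eq R 1)).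
Qed.

Let sphere_compact : compact sphere.
Proof.
pose c (j : 'I_n.-1.+1) : R := 1 + (pi j.+1)^-1.
pose K : set 'rV[R]_n.-1.+1 :=
  [set v | forall j, v ord0 j \in `[- c j, c j]%R].
have cK : compact K.
  apply: (@rV_compact _ _ (fun j => `[- c j, c j]%classic)) => j.
  exact: segment_compact.
apply: subclosed_compact sphere_closed cK _ => v [_ /= v1] j.
have hj : (1 <= j.+1 <= n)%N.
  by rewrite /=; apply: leq_trans (ltn_ord j) _; rewrite (ltn_predK n2).
have p0 := pi0 hj.
have : v ord0 j ^+ 2 * pi j.+1 <= 1.
  rewrite -v1 /mean (bigD1_seq j.+1) ?iota_uniq ?mem_index_iota//=.
  rewrite {1}/fct /= inord_val lerDl big_seq_cond sumr_ge0// => l.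
  rewrite mem_index_iota => /andP[hl _].
  by rewrite mulr_ge0 ?sqr_ge0// ltW// pi0.
rewrite -ler_pdivlMr// div1r => vb.
have b0 : 0 < (pi j.+1)^-1 by rewrite invr_gt0.
by rewrite in_itv /= /c; apply/andP; split; nra.
Qed.

Let normalize f : nonconstant n f -> exists2 v, sphere v &
  dirichlet n nu (fct v) (fct v) = dirichlet n nu f f / var n pi f.
Proof.
move=> /var_gt0 s0; set s := var n pi f in s0 *.
pose r := Num.sqrt s; pose m := mean n pi f.
have r2 : r ^+ 2 = s by rewrite sqr_sqrtr// ltW.
have r0 : r != 0 by rewrite gt_eqF// sqrtr_gt0.
pose h i := r^-1 * f i + - (r^-1 * m).
have meanE g g' : (forall i, (1 <= i <= n)%N -> g i = g' i) ->
    mean n pi g = mean n pi g'.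
  by move=> gg; rewrite /mean; apply: eq_big_nat => i hi; rewrite gg.
exists (vec h).
  split => /=.
    by rewrite (meanE _ h) ?mean_lin ?subrr//; exact: vecK.
  rewrite (meanE _ (fun i => s^-1 * ((f i - m) ^+ 2) + 0)).
    by rewrite mean_lin -var_center addr0 mulVf// gt_eqF.
  by move=> i hi; rewrite vecK// /h -r2; field.
rewrite /dirichlet mulr_suml; apply: eq_big_nat => i /andP[i1 ilt].
rewrite !vecK ?i1 ?(ltnW ilt)//= /h -r2; field.
exact: r0.
Qed.

Let dirichlet_cont :
  continuous (fun v => dirichlet n nu (fct v) (fct v)).
Proof.
rewrite /dirichlet; apply: continuous_big; first exact: add_continuous.
have fc i : continuous (fun v : 'rV[R]_n.-1.+1 => fct v i - fct v i.+1).
  by apply: contB; exact: fct_cont.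
by move=> i _; apply: contM; [exact: contM | exact: cst_continuous].
Qed.

Lemma spectral_gap_min :
  (exists2 f, nonconstant n f &
     spectral_gap n pi nu = dirichlet n nu f f / var n pi f) /\
  (forall g, nonconstant n g ->
     spectral_gap n pi nu <= dirichlet n nu g g / var n pi g).
Proof.
set S := [set dirichlet n nu f f / var n pi f | f in nonconstant n].
have gap_le g : nonconstant n g ->
    spectral_gap n pi nu <= dirichlet n nu g g / var n pi g.
  move=> ng; apply: ge_inf; last by exists g.
  by exists 0 => _ [f nf <-]; rewrite divr_ge0// ltW// var_gt0.
split=> //.
have id_nc : nonconstant n (fun i => i%:R : R).
  exists 1%N, 2%N; split; rewrite ?(ltnW n2)//.
  by move/eqP; rewrite eqr_nat.
have [v0 Kv0 _] := normalize id_nc.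
have [v vK vmin] := compact_EVT_min (ex_intro _ v0 Kv0) sphere_compact
  (continuous_subspaceT dirichlet_cont).
move: vK; rewrite inE => -[/= m0 m1].
have v_nc : nonconstant n (fct v).
  apply: contrapT => vcst.
  have vE i : (1 <= i <= n)%N -> fct v i = fct v 1%N.
    move=> hi; apply: contrapT => ne; apply: vcst; exists i, 1%N.
    by rewrite (ltnW n2).
  have v10 : fct v 1%N = 0.
    rewrite -m0 /mean -[LHS]mulr1 -pi1 mulr_sumr.
    by apply: eq_big_nat => i hi; rewrite vE.
  move: m1; rewrite /mean big_nat_cond big1 => [/esym/eqP|i /andP[hi _]].
    by rewrite oner_eq0.
  by rewrite vE// v10 expr0n mul0r.
exists (fct v) => //.
have v1 : var n pi (fct v) = 1 by rewrite /var m0 m1 expr0n subr0.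
apply/eqP; rewrite eq_le gap_le//=; apply: lb_le_inf.
  by exists (dirichlet n nu (fct v) (fct v) / var n pi (fct v)), (fct v).
move=> _ [g ng <-]; have [w Kw <-] := normalize ng.
by rewrite v1 divr1; apply: vmin; rewrite inE.
Qed.

End SpectralGapMin.

(* Main.v *)
Require Import Defs.
From mathcomp Require Import all_boot all_order all_algebra.
From mathcomp Require Import all_classical all_reals all_analysis.
From mathcomp Require Import ring lra zify.

Set Implicit Arguments.
Unset Strict Implicit.
Unset Printing Implicit Defensive.

Import Order.TTheory GRing.Theory Num.Theory.

Local Open Scope ring_scope.

(** Write gap for the spectral gap, phi for the function built from a value
    lam > 0, S i for the partial sum of phi * pi over 1, ..., i, and
    m = S n for the mean of phi. The mean m controls both the decrement from
    lam to the next value and the distance lam - gap, and comparing the two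
    shows that one step contracts lam - gap by the explicit factor
    sigma = 1 - pi(1) pi(n).

    By induction the truncated recursion says that the flow
    (phi(i+1) - phi(i)) nu(i,i+1) equals lam * max(- S i, 0) ([step_flow]): once
    S becomes nonnegative phi is nonnegative too, so S stays nonnegative and
    phi stays constant. In particular phi is nondecreasing, and summation by
    parts gives E(phi, phi) = lam (Var phi - m (phi(n) - m))
    ([step_dirichlet_self]). The new Rayleigh quotient is therefore
    lam - lam m (phi(n) - m) / Var phi, and the matter is to bound m from below
    by a multiple of lam - gap.

    For this, phi is paired with an eigenfunction chi of the gap. Replacing
    the increments of a minimizer of the Rayleigh quotient by their absolute
    values keeps its energy and does not decrease its variance, so chi can be
    taken nondecreasing, and centred ([nondecr_eigenfunction]). On the one
    hand E(phi, chi) = gap * Cov(phi, chi); on the other hand, since chi is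
    nondecreasing, replacing max(- S i, 0) by - S i in the flow gives
    E(phi, chi) >= lam (Cov(phi, chi) - m chi(n)) ([step_dirichlet_ge]). Hence
    lam m chi(n) >= (lam - gap) Cov(phi, chi). The covariance of two
    nondecreasing functions is at least the contribution of the two end points,
    pi(1) pi(n) (phi(n) - phi(1)) (chi(n) - chi(1)) ([cov_nondecr]), and
    chi(1) <= 0 < chi(n), so
      lam m >= pi(1) pi(n) (lam - gap) (phi(n) - phi(1))    ([step_mean_ge]).
    Combined with the Bhatia-Davis inequality
    Var phi <= (phi(n) - m) (m - phi(1)) ([var_le_ends]), this yields
    new - gap <= (1 - pi(1) pi(n)) (lam - gap) ([step_contraction]) as soon as
    lam >= gap, which holds from lambda_1 on because these are Rayleigh
    quotients. *)

(** * Sums and quadratic inequalities *)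

Lemma sumr_nat_gt0 (R : numDomainType) (m n k : nat) (F : nat -> R) :
  (forall i, (m <= i < n)%N -> 0 <= F i) -> (m <= k < n)%N -> 0 < F k ->
  0 < \sum_(m <= i < n) F i.
Proof.
move=> F0 hk Fk; rewrite (bigD1_seq k) ?mem_index_iota ?iota_uniq//=.
rewrite ltr_pwDl// big_seq_cond sumr_ge0// => i.
by rewrite mem_index_iota => /andP[/F0].
Qed.

(** First-order condition at a minimum: for small t of the sign of - b the
    linear term would win over the quadratic one. *)
Lemma quadratic_ge0_linear (R : realFieldType) (q b : R) :
  (forall t, 0 <= t ^+ 2 * q + 2 * t * b) -> b = 0.
Proof.
move=> H; have [//|b0] := eqVneq b 0.
have q0 : 0 < 1 + `|q| by rewrite ltr_pwDl.
(* This t makes the quadratic equal to a negative multiple of b ^+ 2. *)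
have := H (- b / (1 + `|q|)).
have -> : (- b / (1 + `|q|)) ^+ 2 * q + 2 * (- b / (1 + `|q|)) * b =
   b ^+ 2 * (q - 2 * (1 + `|q|)) / (1 + `|q|) ^+ 2 by field; rewrite gt_eqF.
rewrite pmulr_lge0 ?invr_gt0 ?exprn_gt0// pmulr_rge0; last first.
  by rewrite lt_neqAle sqr_ge0 eq_sym sqrf_eq0 b0.
have := ler_norm q; have := normr_ge0 q; lra.
Qed.

Definition nondecr (R : realType) (n : nat) (f : nat -> R) : Prop :=
  forall i j, (1 <= i <= j)%N -> (j <= n)%N -> f i <= f j.

Definition cov (R : realType) (n : nat) (pi f g : nat -> R) : R :=
  mean n pi (fun i => f i * g i) - mean n pi f * mean n pi g.

Lemma summation_by_parts (R : realType) (n : nat) (pi f g : nat -> R) :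
  (1 <= n)%N ->
  \sum_(1 <= i < n) mean i pi f * (g i.+1 - g i) =
  mean n pi f * g n - mean n pi (fun i => f i * g i).
Proof.
have meanS m h : mean m.+1 pi h = mean m pi h + h m.+1 * pi m.+1.
  by rewrite /mean big_nat_recr.
elim: n => // -[_ _|n IH _].
  by rewrite big_geq// !meanS /mean !big_geq//; ring.
by rewrite big_nat_recr//= IH// !(meanS n.+1); ring.
Qed.

(** * Mean, covariance and variance on the path *)

Section Path.
Variables (R : realType) (n : nat) (pi nu : nat -> R).
Hypothesis n_ge2 : (2 <= n)%N.
Hypothesis pi_gt0 : forall i, (1 <= i <= n)%N -> 0 < pi i.
Hypothesis pi_sum1 : \sum_(1 <= i < n.+1) pi i = 1.
Hypothesis nu_gt0 : forall i, (1 <= i < n)%N -> 0 < nu i.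

Let n_gt0 : (0 < n)%N. Proof. exact: ltnW. Qed.

Lemma eq_mean f g : (forall i, (1 <= i <= n)%N -> f i = g i) ->
  mean n pi f = mean n pi g.
Proof. by move=> fg; apply: eq_big_nat => i hi; rewrite fg. Qed.

Lemma mean_cst c : mean n pi (fun=> c) = c.
Proof. by rewrite /mean -mulr_sumr pi_sum1 mulr1. Qed.

Lemma meanD f g : mean n pi (fun i => f i + g i) = mean n pi f + mean n pi g.
Proof. by rewrite /mean -big_split; apply: eq_bigr => i _; rewrite mulrDl. Qed.

Lemma meanZ c f : mean n pi (fun i => c * f i) = c * mean n pi f.
Proof. by rewrite /mean mulr_sumr; apply: eq_bigr => i _; rewrite mulrA. Qed.

Lemma mean_ge0 f : (forall i, (1 <= i <= n)%N -> 0 <= f i) -> 0 <= mean n pi f.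
Proof.
move=> f0; rewrite /mean big_nat sumr_ge0// => i hi.
by rewrite mulr_ge0 ?f0// ltW// pi_gt0.
Qed.

Lemma ler_mean f g : (forall i, (1 <= i <= n)%N -> f i <= g i) ->
  mean n pi f <= mean n pi g.
Proof.
by move=> fg; apply: ler_sum_nat => i hi; rewrite ler_pM2r ?fg ?pi_gt0.
Qed.

Lemma mean_gt0 k f : (forall i, (1 <= i <= n)%N -> 0 <= f i) ->
  (1 <= k <= n)%N -> 0 < f k -> 0 < mean n pi f.
Proof.
move=> f0 hk fk; apply: (@sumr_nat_gt0 _ _ _ k) => //.
- by move=> i hi; rewrite mulr_ge0 ?f0// ltW// pi_gt0.
- by rewrite mulr_gt0// pi_gt0.
Qed.

Lemma mean_ge_ends f : (forall i, (1 <= i <= n)%N -> 0 <= f i) ->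
  f 1%N * pi 1%N + f n * pi n <= mean n pi f.
Proof.
move=> f0; rewrite /mean big_nat_recr//= lerD2r big_ltn//= lerDl.
rewrite big_nat sumr_ge0// => i hi.
by rewrite mulr_ge0 ?f0 ?(ltW (pi_gt0 _))//; lia.
Qed.

(** The symmetric form of the covariance, in which only differences of values
    appear; comparisons between increments pass to it termwise. *)
Lemma covE f g :
  2 * cov n pi f g =
  mean n pi (fun i => mean n pi (fun j => (f i - f j) * (g i - g j))).
Proof.
transitivity (mean n pi (fun i => f i * g i + (- mean n pi g * f i +
    (- mean n pi f * g i + mean n pi (fun i => f i * g i))))).
  by rewrite !(meanD, meanZ, mean_cst) /cov; ring.
apply: eq_mean => i _.
rewrite (@eq_mean (fun j => (f i - f j) * (g i - g j)) (fun j => f i * g i +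
  (- f i * g j + (- g i * f j + f j * g j)))); last by move=> j _; ring.
by rewrite !(meanD, meanZ, mean_cst); ring.
Qed.

Lemma var_cov f : var n pi f = cov n pi f f.
Proof. by rewrite /var /cov expr2. Qed.

Lemma var_gt0 f : nonconstant n f -> 0 < var n pi f.
Proof.
move=> [i [j [hi hj fij]]]; rewrite var_cov.
suff : 0 < 2 * cov n pi f f by lra.
have sq x y : 0 <= (f x - f y) * (f x - f y) by rewrite -expr2 sqr_ge0.
rewrite covE; apply: (@mean_gt0 i) => //; first by move=> *; exact: mean_ge0.
apply: (@mean_gt0 j) => //.
by rewrite lt_neqAle sq andbT eq_sym mulf_eq0 orbb subr_eq0; apply/eqP.
Qed.

Lemma ler_var f g :
  (forall i j, (1 <= i <= j)%N -> (j <= n)%N -> `|f j - f i| <= `|g j - g i|) ->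
  var n pi f <= var n pi g.
Proof.
move=> fg; rewrite !var_cov.
suff : 2 * cov n pi f f <= 2 * cov n pi g g by lra.
rewrite !covE; apply: ler_mean => i hi; apply: ler_mean => j hj.
rewrite -!expr2 -(real_normK (num_real (f i - f j))).
rewrite -(real_normK (num_real (g i - g j))) lerXn2r ?nnegrE//.
have [ij|ji] := leqP i j; last by apply: fg; lia.
by rewrite distrC (distrC (g i)) fg; lia.
Qed.

(** Chebyshev's association inequality, in quantitative form: all terms of
    [covE] are nonnegative, and the right-hand side keeps only those of the
    pairs (1, n) and (n, 1). *)
Lemma cov_nondecr f g : nondecr n f -> nondecr n g ->
  pi 1%N * pi n * (f n - f 1%N) * (g n - g 1%N) <= cov n pi f g.
Proof.
move=> fm gm.
have sq i j : (1 <= i <= n)%N -> (1 <= j <= n)%N ->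
    0 <= (f i - f j) * (g i - g j).
  move=> hi hj; have [ij|ji] := leqP i j.
    by rewrite -mulrNN mulr_ge0 ?oppr_ge0 ?subr_le0 ?fm ?gm//; lia.
  by rewrite mulr_ge0 ?subr_ge0 ?fm ?gm//; lia.
have inner i : (1 <= i <= n)%N ->
    (f i - f 1%N) * (g i - g 1%N) * pi 1%N + (f i - f n) * (g i - g n) * pi n
    <= mean n pi (fun j => (f i - f j) * (g i - g j)).
  by move=> hi; apply: (mean_ge_ends (f := fun j => _)) => j hj; exact: sq.
have h1 : (1 <= 1 <= n)%N by lia.
have hn : (1 <= n <= n)%N by lia.
have i1 := inner _ h1; have iN := inner _ hn.
have := mean_ge_ends (fun i hi => mean_ge0 (fun j hj => sq i j hi hj)).
rewrite -covE.
move: i1 iN; rewrite !subrr !mul0r add0r addr0.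
have := pi_gt0 h1; have := pi_gt0 hn => pn p1 i1 iN.
have := ler_wpM2r (ltW p1) i1; have := ler_wpM2r (ltW pn) iN; lra.
Qed.

(** The Bhatia-Davis inequality: (f n - f i) * (f i - f 1) is nonnegative, and
    the bound is the expansion of its mean. *)
Lemma var_le_ends f : nondecr n f ->
  var n pi f <= (f n - mean n pi f) * (mean n pi f - f 1%N).
Proof.
move=> fm.
have : 0 <= mean n pi (fun i => (f n - f i) * (f i - f 1%N)).
  by apply: mean_ge0 => i hi; rewrite mulr_ge0// subr_ge0 fm//; lia.
rewrite (@eq_mean _ (fun i => (f n + f 1%N) * f i +
    (- f n * f 1%N + -1 * f i ^+ 2))); last by move=> i _; ring.
rewrite meanD meanZ meanD mean_cst meanZ /var; lra.
Qed.

(** * The Dirichlet form and the spectral gap *)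

Lemma dirichletDl f g h : dirichlet n nu (fun i => f i + g i) h =
  dirichlet n nu f h + dirichlet n nu g h.
Proof. by rewrite -big_split; apply: eq_bigr => i _ /=; ring. Qed.

Lemma dirichletZl c f h : dirichlet n nu (fun i => c * f i) h =
  c * dirichlet n nu f h.
Proof. by rewrite /dirichlet mulr_sumr; apply: eq_bigr => i _; ring. Qed.

Lemma dirichletC f g : dirichlet n nu f g = dirichlet n nu g f.
Proof. by apply: eq_bigr => i _; ring. Qed.

Lemma dirichlet_ge0 f : 0 <= dirichlet n nu f f.
Proof.
rewrite /dirichlet big_nat sumr_ge0// => i hi.
by rewrite mulr_ge0 -?expr2 ?sqr_ge0// ltW// nu_gt0.
Qed.

Lemma dirichlet_gt0 f : nonconstant n f -> 0 < dirichlet n nu f f.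
Proof.
move=> [i [j [hi hj fij]]].
have [k hk fk] : exists2 k, (1 <= k < n)%N & f k <> f k.+1.
  apply: contrapT => nk; apply: fij.
  have fc m : (1 <= m <= n)%N -> f m = f 1%N.
    elim: m => // -[//|m] IH hm; rewrite -IH; last lia.
    by apply: contrapT => fm; apply: nk; exists m.+1; [lia|exact: nesym].
  by rewrite !fc.
have sq m : 0 <= (f m - f m.+1) * (f m - f m.+1) by rewrite -expr2 sqr_ge0.
apply: (@sumr_nat_gt0 _ _ _ k) => // [m hm|].
  by rewrite mulr_ge0// ltW// nu_gt0.
rewrite mulr_gt0 ?nu_gt0// lt_neqAle sq andbT eq_sym mulf_eq0 orbb subr_eq0.
exact/eqP.
Qed.

Local Notation gap := (spectral_gap n pi nu).

Lemma spectral_gap_gt0 : 0 < gap.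
Proof.
have [[f nf ->] _] := spectral_gap_min n_ge2 pi_gt0 pi_sum1 nu_gt0.
by rewrite divr_gt0 ?dirichlet_gt0 ?var_gt0.
Qed.

(** The variational bound without division; it therefore extends to constant
    functions. *)
Lemma poincare f : gap * var n pi f <= dirichlet n nu f f.
Proof.
have [nf|cf] := pselect (nonconstant n f).
  rewrite -ler_pdivlMr ?var_gt0//.
  by have [_ /(_ _ nf)] := spectral_gap_min n_ge2 pi_gt0 pi_sum1 nu_gt0.
rewrite (le_trans _ (dirichlet_ge0 f))// mulr_ge0_le0 ?(ltW spectral_gap_gt0)//.
have -> : 0 = var n pi (fun=> 0).
  by rewrite /var expr0n/= !mean_cst expr0n subrr.
apply: ler_var => i j hi hj; suff -> : f j = f i by rewrite !subrr.
by apply: contrapT => fij; apply: cf; exists j, i; split => //; lia.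
Qed.

(** The Euler-Lagrange equation of the Rayleigh quotient: the quadratic form
    dirichlet - gap * var is nonnegative and vanishes at f, hence f is in the
    kernel of its polar form. *)
Lemma minimizer_weak_eigen f : dirichlet n nu f f <= gap * var n pi f ->
  forall g, dirichlet n nu f g = gap * cov n pi f g.
Proof.
move=> fmin g; apply/eqP; rewrite -subr_eq0; apply/eqP.
apply: (@quadratic_ge0_linear _ (dirichlet n nu g g - gap * var n pi g)) => t.
have := poincare (fun i => f i + t * g i).
rewrite dirichletDl dirichletZl !(dirichletC _ (fun i => f i + _)).
rewrite !dirichletDl !dirichletZl (dirichletC g f).
have -> : var n pi (fun i => f i + t * g i) =
    var n pi f + 2 * t * cov n pi f g + t ^+ 2 * var n pi g.
  rewrite /var /cov (@eq_mean (fun i => (f i + t * g i) ^+ 2) (fun i =>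
    f i ^+ 2 + (2 * t * (f i * g i) + t ^+ 2 * g i ^+ 2))); last first.
    by move=> i _; ring.
  by rewrite !(meanD, meanZ); ring.
by lra.
Qed.

(** Taking the absolute values of the increments of a minimizer of the Rayleigh
    quotient gives another minimizer: the energy only depends on the squares of
    the increments, and the variance can only grow because all differences of
    values grow. The result is then centred. *)
Lemma nondecr_eigenfunction : exists chi : nat -> R,
  [/\ nondecr n chi, mean n pi chi = 0, chi 1%N <= 0, 0 < chi n
    & forall g, dirichlet n nu chi g = gap * cov n pi chi g].
Proof.
have [[f nf gapE] _] := spectral_gap_min n_ge2 pi_gt0 pi_sum1 nu_gt0.
pose h i := \sum_(1 <= j < i) `|f j.+1 - f j|.
have hS i : (1 <= i)%N -> h i.+1 = h i + `|f i.+1 - f i|.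
  by move=> i1; rewrite /h big_nat_recr.
have fh i j : (1 <= i <= j)%N -> `|f j - f i| <= h j - h i.
  move=> /andP[i1 ij]; rewrite -(subnKC ij); elim: (j - i)%N => [|k IH].
    by rewrite addn0 !subrr normr0.
  rewrite addnS hS; last lia.
  have := ler_normD (f (i + k).+1 - f (i + k)%N) (f (i + k)%N - f i).
  rewrite addrA subrK; lra.
have hm i j : (1 <= i <= j)%N -> h i <= h j.
  by move=> /fh hij; rewrite -subr_ge0; apply: le_trans hij.
pose chi i := h i - mean n pi h.
have chi0 : mean n pi chi = 0 by rewrite /chi meanD mean_cst subrr.
have chim : nondecr n chi by move=> i j hij _; rewrite lerD2r hm.
have lt1n : chi 1%N < chi n.
  have [i [j [hi hj fij]]] := nf.
  rewrite lt_neqAle chim ?andbT//.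
  apply/eqP => /addIr h1n; apply: fij.
  have f1 k : (1 <= k <= n)%N -> f k = f 1%N.
    move=> hk; apply/eqP; rewrite -subr_eq0 -normr_le0.
    have := hm k n hk; rewrite -h1n => hk1.
    by apply: le_trans (fh 1%N k _) _; [lia | rewrite subr_le0].
  by rewrite !f1.
exists chi; split => //.
- rewrite -chi0 -[leLHS]mean_cst; apply: ler_mean => i hi.
  by apply: chim; lia.
- rewrite -chi0 -[ltRHS]mean_cst -subr_gt0 -mulN1r -meanZ -meanD.
  apply: (@mean_gt0 1%N); [|lia|by lra].
  by move=> i hi; have := chim i n hi (leqnn n); lra.
- apply: minimizer_weak_eigen; have vf := var_gt0 nf.
  have -> : dirichlet n nu chi chi = dirichlet n nu f f.
    apply: eq_big_nat => i /andP[i1 _]; rewrite /chi hS//.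
    transitivity (`|f i.+1 - f i| ^+ 2 * nu i); first by ring.
    by rewrite real_normK ?num_real//; ring.
  have -> : dirichlet n nu f f = gap * var n pi f.
    by rewrite gapE mulfVK// gt_eqF.
  rewrite ler_pM2l ?spectral_gap_gt0//; apply: ler_var => i j hij _.
  have -> : chi j - chi i = h j - h i by rewrite /chi; ring.
  by rewrite (le_trans (fh _ _ hij))// ler_norm.
Qed.

(** * One step of the iteration *)

Section Step.
Variables (a lam : R) (phi : nat -> R).
Hypothesis nu_left : nu 0%N = 0.
Hypotheses (a_gt0 : 0 < a) (lam_gt0 : 0 < lam).
Hypothesis phi1 : phi 1%N = - a.
Hypothesis phiS : forall i, (1 <= i < n)%N -> phi i.+1 = phi i +
  Num.max ((phi i - phi i.-1) * nu i.-1 - lam * pi i * phi i) 0 / nu i.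

Let S i := mean i pi phi.

Let SS i : S i.+1 = S i + phi i.+1 * pi i.+1.
Proof. by rewrite /S /mean big_nat_recr. Qed.

Lemma step_nondecr : nondecr n phi.
Proof.
move=> i j /andP[i1 ij]; rewrite -(subnKC ij).
elim: (j - i)%N => [|k IH] hk; first by rewrite addn0.
rewrite addnS phiS ?(le_trans (IH _))//; try lia.
by rewrite lerDl divr_ge0 ?le_max ?lexx ?orbT// ltW// nu_gt0; lia.
Qed.

Let S_le i : (1 <= i <= n)%N -> 0 <= S i -> 0 <= phi i.
Proof.
move=> hi; apply: contraTT; rewrite -!ltNge => phi_lt0.
rewrite -oppr_gt0 /S /mean -sumrN; apply: (@sumr_nat_gt0 _ _ _ i) => [j hj||].
- rewrite oppr_ge0 pmulr_lle0; last by apply: pi_gt0; lia.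
  by rewrite (le_trans _ (ltW phi_lt0))// step_nondecr//; lia.
- lia.
- by rewrite oppr_gt0 pmulr_llt0// pi_gt0.
Qed.

(** The flow through the edge {i, i+1} in closed form. As long as the partial
    sums are negative the truncation is inactive and the recursion telescopes. Once
    S i is nonnegative, monotonicity of phi gives phi >= 0 from i on, so the
    truncation keeps the flow at 0 and the sums stay nonnegative. *)
Lemma step_flow i : (1 <= i < n)%N ->
  (phi i.+1 - phi i) * nu i = lam * Num.max (- S i) 0.
Proof.
have flow j : (1 <= j < n)%N -> (phi j.+1 - phi j) * nu j =
    Num.max ((phi j - phi j.-1) * nu j.-1 - lam * pi j * phi j) 0.
  by move=> hj; rewrite phiS// addrC addKr divfK// gt_eqF// nu_gt0.
elim: i => // -[_ h|i IH h].
  rewrite flow// nu_left /S /mean big_nat1 maxr_pMr ?(ltW lam_gt0)//.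
  by congr Num.max; ring.
rewrite flow// [_.-1]/= IH; last lia.
rewrite [RHS]maxr_pMr ?(ltW lam_gt0)// mulr0 (SS i.+1).
have pi2 : 0 < pi i.+2 by apply: pi_gt0; lia.
have [S0|S0] := leP 0 (S i.+1); last first.
  by rewrite (@max_l _ _ (- S _)) ?oppr_ge0 ?ltW//; congr Num.max; ring.
have phi0 : 0 <= phi i.+2.
  rewrite (le_trans (S_le _ S0)) ?step_nondecr//; lia.
have := mulr_ge0 phi0 (ltW pi2) => pp.
rewrite (@max_r _ _ (- S i.+1)) ?oppr_le0// !max_r//; last first.
  by have := mulr_ge0 (ltW lam_gt0) pp; lra.
by rewrite pmulr_rle0//; lra.
Qed.

Lemma step_dirichlet g : dirichlet n nu phi g =
  lam * \sum_(1 <= i < n) Num.max (- S i) 0 * (g i.+1 - g i).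
Proof.
rewrite /dirichlet mulr_sumr; apply: eq_big_nat => i hi.
by rewrite mulrA -step_flow//; ring.
Qed.

Lemma step_dirichlet_ge g : nondecr n g ->
  lam * (mean n pi (fun i => phi i * g i) - mean n pi phi * g n)
  <= dirichlet n nu phi g.
Proof.
move=> gm; rewrite step_dirichlet ler_pM2l// -opprB -summation_by_parts//.
rewrite -sumrN; apply: ler_sum_nat => i hi.
rewrite -mulNr ler_wpM2r ?le_max ?lexx// subr_ge0 gm//; lia.
Qed.

(** Equality holds in [step_dirichlet_ge] for g = phi, because phi does not
    increase across the edges on which the truncation is active. *)
Lemma step_dirichlet_self : dirichlet n nu phi phi =
  lam * (mean n pi (fun i => phi i * phi i) - mean n pi phi * phi n).
Proof.
rewrite step_dirichlet; congr (_ * _).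
rewrite -opprB -summation_by_parts// -sumrN; apply: eq_big_nat => i hi.
rewrite -mulNr; have [S0|S0] := leP 0 (S i); last first.
  by rewrite max_l ?oppr_ge0 ?ltW.
suff -> : phi i.+1 - phi i = 0 by rewrite !mulr0.
have /eqP := step_flow hi; rewrite max_r ?oppr_le0// mulr0 mulf_eq0.
by rewrite (gt_eqF (nu_gt0 hi)) orbF => /eqP.
Qed.

Lemma step_nonconstant : nonconstant n phi.
Proof.
exists 2%N, 1%N; split; [lia|lia|].
have h : (1 <= 1 < n)%N by lia.
move=> e; have /eqP := step_flow h; rewrite e subrr mul0r eq_sym.
rewrite /S /mean big_nat1 phi1 mulNr opprK gt_eqF// mulr_gt0// lt_max.
by rewrite mulr_gt0// pi_gt0//; lia.
Qed.

(** The mean of phi measures how far lam is above the gap: this is what comes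
    out of testing phi against the monotone eigenfunction chi, after
    simplification by chi n. *)
Lemma step_mean_ge : gap <= lam ->
  pi 1%N * pi n * (lam - gap) * (phi n - phi 1%N) <= lam * mean n pi phi.
Proof.
move=> gap_le.
have [chi [chim chi0 chi1 chin eig]] := nondecr_eigenfunction.
have := step_dirichlet_ge chim; have := cov_nondecr step_nondecr chim.
rewrite dirichletC eig.
have -> : cov n pi chi phi = cov n pi phi chi.
  rewrite /cov (@eq_mean (fun i => chi i * phi i) (fun i => phi i * chi i)).
    by ring.
  by move=> i _; ring.
have -> : mean n pi (fun i => phi i * chi i) = cov n pi phi chi.
  by rewrite /cov chi0 mulr0 subr0.
set C := cov _ _ _ _; set m := mean _ _ _ => C_ge flow_ge.
set D := phi n - phi 1%N in C_ge *.
have D0 : 0 <= D by rewrite subr_ge0 step_nondecr//; lia.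
have p0 : 0 <= pi 1%N * pi n by rewrite ltW// mulr_gt0// pi_gt0//; lia.
have C_ge' : pi 1%N * pi n * D * chi n <= C.
  apply: le_trans C_ge; rewrite (ler_wpM2l (mulr_ge0 p0 D0))//.
  by rewrite lerDl oppr_ge0.
rewrite -(ler_pM2r chin).
have : 0 <= lam - gap by lra.
move=> /ler_wpM2l/(_ _ _ C_ge'); lra.
Qed.

(** The new value is lam - lam * m * (phi n - m) / Var phi, with m the mean; the
    decrement is bounded below by [step_mean_ge] for lam * m and by the
    Bhatia-Davis inequality for (phi n - m) / Var phi. *)
Lemma step_contraction : gap <= lam ->
  dirichlet n nu phi phi / var n pi phi - gap
  <= (1 - pi 1%N * pi n) * (lam - gap).
Proof.
move=> gap_le; have v0 := var_gt0 step_nonconstant.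
rewrite lerBlDr ler_pdivrMr// step_dirichlet_self.
have -> : mean n pi (fun i => phi i * phi i) =
    var n pi phi + mean n pi phi * mean n pi phi.
  by rewrite var_cov /cov subrK.
have BD := var_le_ends step_nondecr; have M := step_mean_ge gap_le.
set m := mean n pi phi in BD M *; set v := var n pi phi in v0 BD *.
have p0 : 0 < pi 1%N * pi n by rewrite mulr_gt0// pi_gt0//; lia.
have D0 : phi 1%N <= phi n by rewrite step_nondecr//; lia.
have mn : m <= phi n.
  rewrite -[leRHS]mean_cst; apply: ler_mean => i hi; apply: step_nondecr; lia.
have BD' : v <= (phi n - m) * (phi n - phi 1%N).
  apply: le_trans BD _; rewrite ler_wpM2l ?subr_ge0// lerD2r//.
have pl : 0 <= pi 1%N * pi n * (lam - gap).
  by rewrite mulr_ge0 ?subr_ge0// ltW.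
have := ler_wpM2l pl BD'.
have : 0 <= phi n - m by rewrite subr_ge0.
move=> /ler_wpM2r/(_ _ _ M); lra.
Qed.

End Step.

(** As n >= 2, the end points are distinct and pi 1 + pi n <= 1. *)
Lemma pi_ends_lt1 : pi 1%N * pi n < 1.
Proof.
have p1 : 0 < pi 1%N by apply: pi_gt0; lia.
have pn : 0 < pi n by apply: pi_gt0; lia.
have := @mean_ge_ends (fun=> 1) (fun _ _ => ler01).
by rewrite mean_cst !mul1r => h; nra.
Qed.

End Path.

(** * Convergence of the iteration *)

Theorem theorem1p3 (R : realType) (n : nat) (pi nu : nat -> R)
  (n_ge2 : (2 <= n)%N)
  (pi_gt0 : forall i, (1 <= i <= n)%N -> 0 < pi i)
  (pi_sum1 : \sum_(1 <= i < n.+1) pi i = 1)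
  (nu_gt0 : forall i, (1 <= i < n)%N -> 0 < nu i)
  (nu_left : nu 0%N = 0)
  (nu_right : nu n = 0) :
  exists sigma : R, 0 < sigma < 1 /\
    forall (lambda0 a : R), 0 < lambda0 -> 0 < a ->
    forall (lambda : nat -> R) (psi : nat -> nat -> R),
      lambda 0%N = lambda0 ->
      (forall k, psi k 1%N = - a) ->
      (forall k i, (1 <= i < n)%N ->
         psi k i.+1 = psi k i +
           Num.max ((psi k i - psi k i.-1) * nu i.-1
                    - lambda k * pi i * psi k i) 0 / nu i) ->
      (forall k, lambda k.+1 = dirichlet n nu (psi k) (psi k)
                               / var n pi (psi k)) ->
      forall k, (1 <= k)%N ->
        0 <= lambda k - spectral_gap n pi nu <= sigma ^+ k.-1 * lambda 1%N.
Proof.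
have p_lt1 := pi_ends_lt1 n_ge2 pi_gt0 pi_sum1.
have p_gt0 : 0 < pi 1%N * pi n by rewrite mulr_gt0// pi_gt0//; lia.
exists (1 - pi 1%N * pi n); split; first by rewrite subr_gt0 p_lt1/=; lra.
move=> lambda0 a lambda0_gt0 a_gt0 lambda psi lambdaE psi1 psiS lambdaS.
have gap_gt0 := spectral_gap_gt0 n_ge2 pi_gt0 pi_sum1 nu_gt0.
set gap := spectral_gap n pi nu in gap_gt0 *.
have gap_le_next k : 0 < lambda k -> gap <= lambda k.+1.
  move=> lk; rewrite lambdaS ler_pdivlMr.
    exact: (poincare n_ge2 pi_gt0 pi_sum1 nu_gt0).
  apply: (var_gt0 pi_gt0 pi_sum1).
  exact: (step_nonconstant n_ge2 pi_gt0 nu_gt0 nu_left a_gt0 lk (psi1 k)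
    (psiS k)).
have gap_le k : gap <= lambda k.+1.
  elim: k => [|k IH]; apply: gap_le_next; first by rewrite lambdaE.
  exact: lt_le_trans IH.
case=> // k _; rewrite subr_ge0 gap_le/=.
elim: k => [|k IH]; first by rewrite expr0 mul1r; lra.
rewrite exprS -mulrA lambdaS.
apply: le_trans (_ : (1 - pi 1%N * pi n) * (lambda k.+1 - gap) <= _).
  exact: (step_contraction n_ge2 pi_gt0 pi_sum1 nu_gt0 nu_left a_gt0
    (lt_le_trans gap_gt0 (gap_le k)) (psi1 k.+1) (psiS k.+1) (gap_le k)).
by rewrite ler_pM2l// subr_gt0.
Qed.
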